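(* Let $\mathbb{F}$ be a field and let $A_\bullet=(A_1,\dots,A_\ell)$ be a sequence of matrices over $\mathbb{F}$ defining a zigzag module $$\mathbb{F}^{n_0}\overset{A_1}{\longleftrightarrow}\mathbb{F}^{n_1}\overset{A_2}{\longleftrightarrow}\cdots\overset{A_\ell}{\longleftrightarrow}\mathbb{F}^{n_\ell}$$ of some type $\tau$. Then there is $g\in G=\prod_{i=0}^{\ell}\mathrm{GL}(n_i;\mathbb{F})$ such that $(gA)_\bullet$ has all its matrices in zigzag barcode form.
   Context: The type $\tau$ specifies for each $1\le i\le\ell$ whether the $i$-th map is forward ($\mathbb{F}^{n_{i-1}}\to\mathbb{F}^{n_i}$, so $A_i$ is $n_i\times n_{i-1}$) or backward ($\mathbb{F}^{n_{i-1}}\leftarrow\mathbb{F}^{n_i}$, so $A_i$ is $n_{i-1}\times n_i$). The group $G$ acts by $(gA)_i=g_iA_ig_{i-1}^{-1}$ if the $i$-th map is forward and $(gA)_i=g_{i-1}A_ig_i^{-1}$ if it is backward. An $m\times n$ matrix of rank $r$ is in barcode form if there is a strictly increasing $c:\{1,\dots,r\}\to\{1,\dots,n\}$ such that the $(i,j)$ entry is $1$ if $i\le r$ and $j=c(i)$, and $0$ otherwise. It is in reversed barcode form if there is a strictly increasing $c:\{n-r+1,\dots,n\}\to\{1,\dots,m\}$ such that the $(i,j)$ entry is $1$ if $j\ge n-r+1$ and $i=c(j)$, and $0$ otherwise (so the $r$ nonzero entries lie in the last $r$ columns, in increasing row order). The sequence $A_\bullet$ is in zigzag barcode form if $A_i$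 is in barcode form for every forward $i$ and in reversed barcode form for every backward $i$. *)

(* Defs.v *)
From HB Require Import structures.
From mathcomp Require Import all_boot all_order all_algebra.

Set Implicit Arguments.
Unset Strict Implicit.
Unset Printing Implicit Defensive.

Import GRing.Theory.
Local Open Scope ring_scope.

Inductive direction := Forward | Backward.

(* Matrices act on column vectors. *)
Definition zigzag_map (F : fieldType) (d : direction) (p q : nat) : Type :=
  match d with
  | Forward => 'M[F]_(q, p)
  | Backward => 'M[F]_(p, q)
  end.

Definition act_map (F : fieldType) (d : direction) (p q : nat)
    (h : 'M[F]_p) (g : 'M[F]_q) : zigzag_map F d p q -> zigzag_map F d p q :=
  match d with
  | Forward => fun A => g *m A *m invmx h
  | Backward => fun A => h *m A *m invmx g
  end.

(* The i-th map, i in {0, ..., l-1}, joins the spaces number i and i+1. *)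
Definition left_end (l : nat) (i : 'I_l) : 'I_l.+1 := widen_ord (leqnSn l) i.
Definition right_end (l : nat) (i : 'I_l) : 'I_l.+1 := lift ord0 i.

Definition zigzag_module (F : fieldType) (l : nat) (n : 'I_l.+1 -> nat)
    (tau : 'I_l -> direction) : Type :=
  forall i : 'I_l, zigzag_map F (tau i) (n (left_end i)) (n (right_end i)).

Definition zigzag_act (F : fieldType) (l : nat) (n : 'I_l.+1 -> nat)
    (tau : 'I_l -> direction) (g : forall i : 'I_l.+1, 'M[F]_(n i))
    (A : zigzag_module F n tau) : zigzag_module F n tau :=
  fun i => act_map (g (left_end i)) (g (right_end i)) (A i).

Definition barcode_form (F : fieldType) (m n : nat) (A : 'M[F]_(m, n)) : Prop :=
  exists c : 'I_(\rank A) -> 'I_n,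
    {homo c : k k' / (k < k')%N} /\
    forall (i : 'I_m) (j : 'I_n),
      A i j = [exists k : 'I_(\rank A), (i == k :> nat) && (j == c k)]%:R.

(* Writing r for the rank, the 0-based indices n - r, ..., n - 1 of the last r
   columns are parametrised as n - r + k with k < r, and c k is the row of the
   nonzero entry in that column; the truncated subtraction is exact since
   r <= n. *)
Definition reversed_barcode_form (F : fieldType) (m n : nat)
    (A : 'M[F]_(m, n)) : Prop :=
  exists c : 'I_(\rank A) -> 'I_m,
    {homo c : k k' / (k < k')%N} /\
    forall (i : 'I_m) (j : 'I_n),
      A i j = [exists k : 'I_(\rank A),
                 (j == (n - \rank A + k)%N :> nat) && (i == c k)]%:R.

Definition map_barcode_form (F : fieldType) (d : direction) (p q : nat) :
    zigzag_map F d p q -> Prop :=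
  match d with
  | Forward => fun A => barcode_form A
  | Backward => fun A => reversed_barcode_form A
  end.

Definition zigzag_barcode_form (F : fieldType) (l : nat) (n : 'I_l.+1 -> nat)
    (tau : 'I_l -> direction) (A : zigzag_module F n tau) : Prop :=
  forall i : 'I_l, map_barcode_form (A i).

(* Main.v *)
(* Every matrix is, up to row operations, B u with B in barcode form and u
   invertible upper triangular; and if g is invertible upper triangular then
   g B = B h for some h of the same kind. Reflecting in the antidiagonal gives
   the analogous facts for reversed barcode forms. So one chooses bases from
   left to right to put every map in the form B u (or u B, if backward), and
   then, from right to left, upper triangular changes of basis that absorb
   the factors u. *)
Require Import Defs.
From HB Require Import structures.
From mathcomp Require Import all_boot all_order all_algebra.
From mathcomp Require Import zify.

Set Implicit Arguments.
Unset Strict Implicit.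
Unset Printing Implicit Defensive.

Import GRing.Theory.
Local Open Scope ring_scope.

(** * Invertible upper triangular matrices *)

(** [is_trig_mx] means lower triangular, hence the transpose. *)
Definition upper_unit (F : fieldType) (n : nat) (u : 'M[F]_n) : bool :=
  is_trig_mx u^T && (u \in unitmx).

Lemma upper_unit1 (F : fieldType) (n : nat) : upper_unit (1%:M : 'M[F]_n).
Proof. by rewrite /upper_unit trmx1 scalar_mx_is_trig unitmx1. Qed.

Lemma upper_unit_unit (F : fieldType) (n : nat) (u : 'M[F]_n) :
  upper_unit u -> u \in unitmx.
Proof. by case/andP. Qed.

Lemma upper_unit_block (F : fieldType) (n : nat) (a : 'M[F]_1)
    (b : 'M[F]_(1, n)) (d : 'M[F]_n) :
  upper_unit (block_mx a b 0 d : 'M_(1 + n)) = (a \in unitmx) && upper_unit d.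
Proof.
rewrite /upper_unit tr_block_mx trmx0 is_trig_block_mx // eqxx mx11_is_trig /=.
by rewrite !unitmxE det_ublock unitrM andbCA.
Qed.

Lemma upper_unit_blockP (F : fieldType) (n : nat) (u : 'M[F]_(1 + n)) :
  upper_unit u ->
  exists a b d, [/\ u = block_mx a b 0 d, a \in unitmx & upper_unit d].
Proof.
move=> uu; exists (ulsubmx u), (ursubmx u), (drsubmx u).
have dl0 : dlsubmx u = 0.
  by case/andP: uu => tu _; rewrite -[LHS]trmxK trmx_dlsub ursubmx_trig ?trmx0.
have ublk : u = block_mx (ulsubmx u) (ursubmx u) 0 (drsubmx u).
  by rewrite -dl0 submxK.
by move: uu; rewrite {1}ublk upper_unit_block => /andP[].
Qed.

Lemma upper_unitM (F : fieldType) (n : nat) (u v : 'M[F]_n) :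
  upper_unit u -> upper_unit v -> upper_unit (u *m v).
Proof.
elim: n => [|n IHn] in u v *.
  by rewrite [u *m v](_ : _ = 1%:M) ?upper_unit1 //; apply/matrixP=> - [].
rewrite -[n.+1]/(1 + n)%N in u v * => /upper_unit_blockP[a [b [d [-> ua ud]]]].
move=> /upper_unit_blockP[a' [b' [d' [-> ua' ud']]]].
rewrite mulmx_block !(mul0mx, mulmx0, addr0, add0r).
by rewrite upper_unit_block unitmx_mul ua ua' IHn.
Qed.

Lemma upper_unitV (F : fieldType) (n : nat) (u : 'M[F]_n) :
  upper_unit u -> upper_unit (invmx u).
Proof.
elim: n => [|n IHn] in u *.
  by rewrite [invmx u](_ : _ = 1%:M) ?upper_unit1 //; apply/matrixP=> - [].
rewrite -[n.+1]/(1 + n)%N in u * => /[dup] /upper_unit_unit uu.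
move=> /upper_unit_blockP[a [b [d [ublk ua ud]]]].
(* The corner block is the solution [y] of [a y + b d^-1 = 0]. *)
pose w : 'M_(1 + n) :=
  block_mx (invmx a) (- (invmx a *m b *m invmx d)) (0 : 'cV_n) (invmx d).
have uw : u *m w = 1%:M.
  rewrite ublk mulmx_block !(mul0mx, mulmx0, addr0, add0r).
  rewrite mulmxN !mulmxA !mulmxV ?(upper_unit_unit ud) // mul1mx addNr.
  by rewrite -scalar_mx_block.
suff -> : invmx u = w by rewrite upper_unit_block unitmx_inv ua IHn.
by rewrite -[w](mulKmx uu) uw mulmx1.
Qed.

(** * Barcode forms: reduction and compatibility with triangular matrices *)

(* An inductive form of [barcode_form] that avoids ordinals indexed by a rank. *)
Inductive barcode (F : fieldType) : forall m n, 'M[F]_(m, n) -> Prop :=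
| barcode_nil m (B : 'M_(m, 0)) : barcode B
| barcode_skip m n (B : 'M_(m, n)) :
    barcode B -> @barcode F m (1 + n) (row_mx (0 : 'cV_m) B)
| barcode_pivot m n (B : 'M_(m, n)) :
    barcode B -> @barcode F (1 + m) (1 + n) (block_mx 1%:M 0 0 B).

(** A nonzero column has rank 1, so its rank factorization is an invertible matrix times the first
    unit column times an invertible scalar. *)
Lemma col_pivot (F : fieldType) (m : nat) (a : 'cV[F]_(1 + m)) :
  a != 0 -> exists (g : 'M[F]_(1 + m)) (s : 'M[F]_1),
    [/\ g \in unitmx, s \in unitmx & g *m a = col_mx s 0].
Proof.
move=> a0; exists (invmx (col_ebase a)), (row_ebase a).
rewrite unitmx_inv col_ebase_unit row_ebase_unit; split=> //.
rewrite -{2}(mulmx_ebase a) -mulmxA mulKmx ?col_ebase_unit //.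
have -> : \rank a = 1%N.
  by apply/eqP; rewrite eqn_leq rank_leq_col lt0n mxrank_eq0.
rewrite -[RHS]mul1mx -[col_mx _ _]/(col_mx (row_ebase a) 0).
have -> : pid_mx 1 = col_mx 1%:M 0 :> 'M[F]_(1 + m, 1).
  rewrite pid_mx_col; congr col_mx; exact: pid_mx_1.
by rewrite mul1mx mul_col_mx mul1mx mul0mx.
Qed.

(** Gaussian elimination column by column. A zero first column is skipped; otherwise a pivot is
    moved to the top and the recursion treats the rows below it. The rest of the pivot row is not
    cleared but stored in the first row of [u]. *)
Lemma barcode_reduction (F : fieldType) (m n : nat) (A : 'M[F]_(m, n)) :
  exists (g : 'M[F]_m) (B : 'M[F]_(m, n)) (u : 'M[F]_n),
    [/\ g \in unitmx, barcode B, upper_unit u & g *m A = B *m u].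
Proof.
elim: n => [|n IHn] in m A *.
  exists 1%:M, A, 1%:M; split; rewrite ?unitmx1 ?upper_unit1 //.
    exact: barcode_nil.
  by rewrite mul1mx mulmx1.
rewrite -[n.+1]/(1 + n)%N in A *; rewrite -[A]hsubmxK.
set a := lsubmx _; set A' := rsubmx _.
have [a0|a0] := eqVneq a 0.
  have [g [B [u [ug bB uu gA]]]] := IHn m A'.
  exists g, (row_mx (0 : 'cV_m) B), (block_mx (1%:M : 'M_1) 0 0 u).
  split=> //; first exact: barcode_skip.
    by rewrite upper_unit_block unitmx1 uu.
  rewrite a0 mul_mx_row mulmx0 gA.
  by rewrite mul_row_block !(mul0mx, mulmx0, addr0, add0r).
move: a A' a0 => {A}; case: m => [|m] a A' a0; first by rewrite flatmx0 eqxx in a0.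
rewrite -[m.+1]/(1 + m)%N in a A' a0 *.
have [g0 [s [ug0 us g0a]]] := col_pivot a0.
pose C : 'M_(1 + m, n) := g0 *m A'.
have [g [B [u [ug bB uu gC]]]] := IHn m (dsubmx C).
exists (block_mx (1%:M : 'M_1) 0 0 g *m g0), (block_mx (1%:M : 'M_1) 0 0 B),
  (block_mx s (usubmx C) 0 u).
split.
- by rewrite unitmx_mul ug0 andbT block_diag_mx_unit unitmx1.
- exact: barcode_pivot.
- by rewrite upper_unit_block us.
rewrite -mulmxA mul_mx_row g0a -/C -{1}(vsubmxK C) -block_mxEh.
rewrite !mulmx_block.
by rewrite !(mul1mx, mulmx1, mul0mx, mulmx0, addr0, add0r) gC.
Qed.

(** At a pivot, [u] has blocks [a], [b], [0], [d]; the zero below [a] keeps the pivot column clean,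
    and the new top row [(a, b B)] becomes the first row of [h], while induction handles [d]. *)
Lemma barcode_stabilizer (F : fieldType) (m n : nat) (B : 'M[F]_(m, n)) :
  barcode B -> forall u : 'M[F]_m, upper_unit u ->
  exists2 h : 'M[F]_n, upper_unit h & u *m B = B *m h.
Proof.
elim=> {m n B} [m B|m n B _ IH|m n B _ IH] u uu.
- exists 1%:M; first exact: upper_unit1.
  by rewrite [LHS]thinmx0 [RHS]thinmx0.
- have [h uh uB] := IH u uu.
  exists (block_mx (1%:M : 'M_1) 0 0 h).
    by rewrite upper_unit_block unitmx1.
  by rewrite mul_mx_row mul_row_block uB !(mul0mx, mulmx0, addr0, add0r).
have [a [b [d [-> ua ud]]]] := upper_unit_blockP uu.
have [h uh dB] := IH d ud.
exists (block_mx a (b *m B) 0 h); first by rewrite upper_unit_block ua.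
by rewrite !mulmx_block dB !(mul1mx, mulmx1, mul0mx, mulmx0, addr0, add0r).
Qed.

(** Pivot columns are indexed by [nat] so that the rank can change along the induction without
    casts; values of [c] from the rank on are arbitrary. *)
Lemma barcode_columns (F : fieldType) (m n : nat) (B : 'M[F]_(m, n)) :
  barcode B -> exists c : nat -> nat,
    [/\ forall k k', (k < k' < \rank B)%N -> (c k < c k')%N,
        forall k, (k < \rank B)%N -> (c k < n)%N &
        forall i j, B i j = ((i < \rank B)%N && (j == c i :> nat))%:R].
Proof.
elim=> {m n B} [m B|m n B _ [c [cI cn Bc]]|m n B _ [c [cI cn Bc]]].
- exists id; rewrite thinmx0 mxrank0.
  by split=> [k k'|k|i []] //; rewrite ltn0 andbF.
- exists (fun k => (c k).+1); rewrite rank_row_0mx; split=> // i j.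
  rewrite mxE; case: splitP => j' ->; first by rewrite mxE (ord1 j') andbF.
  by rewrite Bc eqSS.
exists (fun k => if k is k'.+1 then (c k').+1 else 0%N).
rewrite rank_diag_block_mx mxrank1; split.
- case=> [|k] [|k'] //=; exact: cI.
- case=> [|k] //=; exact: cn.
move=> i j; rewrite mxE; case: splitP => i' ->; rewrite mxE; case: splitP => j' ->.
- by rewrite !ord1 mxE.
- by rewrite !ord1 mxE.
- by rewrite !ord1 mxE andbF.
by rewrite Bc.
Qed.

Lemma barcodeW (F : fieldType) (m n : nat) (B : 'M[F]_(m, n)) :
  barcode B -> barcode_form B.
Proof.
move=> /barcode_columns[c [cI cn Bc]].
exists (fun k : 'I_(\rank B) => Ordinal (cn k (ltn_ord k))); split=> [k k' kk'|i j] /=.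
  by apply: cI; rewrite kk' ltn_ord.
rewrite Bc; congr (nat_of_bool _)%:R; apply/andP/existsP=> [[ir jc]|[k]].
  by exists (Ordinal ir); rewrite /= eqxx.
by case/andP=> /eqP-> /eqP->; rewrite /= ltn_ord eqxx.
Qed.

(* Reflection in the antidiagonal: it reverses products, preserves upper
   triangularity and exchanges barcode form with reversed barcode form. *)
Definition antitr (F : fieldType) (m n : nat) (A : 'M[F]_(m, n)) : 'M[F]_(n, m) :=
  \matrix_(i, j) A (rev_ord j) (rev_ord i).

Lemma antitrK (F : fieldType) (m n : nat) : cancel (@antitr F m n) (@antitr F n m).
Proof. by move=> A; apply/matrixP=> i j; rewrite !mxE !rev_ordK. Qed.

Lemma antitrM (F : fieldType) (m n p : nat) (A : 'M[F]_(m, n))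
    (B : 'M[F]_(n, p)) :
  antitr (A *m B) = antitr B *m antitr A.
Proof.
apply/matrixP=> i j; rewrite !mxE (reindex_inj rev_ord_inj) /=.
by apply: eq_bigr => k _; rewrite !mxE mulrC.
Qed.

Lemma antitr1 (F : fieldType) (n : nat) : antitr (1%:M : 'M[F]_n) = 1%:M.
Proof.
by apply/matrixP=> i j; rewrite !mxE (inj_eq rev_ord_inj) eq_sym.
Qed.

Lemma antitr_unit (F : fieldType) (n : nat) (A : 'M[F]_n) :
  A \in unitmx -> antitr A \in unitmx.
Proof.
move=> uA; suff /mulmx1_unit[] : antitr A *m antitr (invmx A) = 1%:M by [].
by rewrite -antitrM mulVmx // antitr1.
Qed.

(** Reversing both indices and then swapping them preserves which side of the diagonal an entry lies
    on. *)
Lemma antitr_upper_unit (F : fieldType) (n : nat) (u : 'M[F]_n) :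
  upper_unit u -> upper_unit (antitr u).
Proof.
case/andP=> /is_trig_mxP tu uu; rewrite /upper_unit antitr_unit // andbT.
apply/is_trig_mxP=> i j ij; have := tu (rev_ord j) (rev_ord i).
by rewrite !mxE /=; apply; move: (ltn_ord i) (ltn_ord j); lia.
Qed.

(** A rank factorization reflects to one through the same inner dimension, so the rank cannot grow;
    the reflection being an involution, it cannot drop either. *)
Lemma mxrank_antitr (F : fieldType) (m n : nat) (A : 'M[F]_(m, n)) :
  \rank (antitr A) = \rank A.
Proof.
have leA p q (C : 'M[F]_(p, q)) : (\rank (antitr C) <= \rank C)%N.
  rewrite -{1}(mulmx_base C) antitrM.
  exact: leq_trans (mxrankM_maxl _ _) (rank_leq_col _).
by apply/eqP; rewrite eqn_leq leA -{1}(antitrK A) leA.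
Qed.

Lemma barcode_antitrW (F : fieldType) (m n : nat) (A : 'M[F]_(m, n)) :
  barcode (antitr A) -> reversed_barcode_form A.
Proof.
move=> /barcode_columns[c]; rewrite mxrank_antitr /reversed_barcode_form.
move: (\rank A) (rank_leq_col A) => r rn [cI cm Ac].
have Aij i j : A i j = ((n - j.+1 < r)%N && (m - i.+1 == c (n - j.+1))%N)%:R.
  by rewrite -(antitrK A) mxE Ac.
have cP (k : 'I_r) : (m - (c (r - k.+1)).+1 < m)%N.
  by have := ltn_ord k; have := cm (r - k.+1)%N; lia.
(* The pivot [(s, c s)] of the reflected matrix lands in column [n - 1 - s] and row [m - 1 - c s].
   Column [n - r + k] thus corresponds to [s = r - 1 - k], and the two reversals make the rows
   increase with [k]. *)
exists (fun k => Ordinal (cP k)); split=> [k k' kk'|i j] /=.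
  have kr' := ltn_ord k'.
  have cc : (c (r - k'.+1) < c (r - k.+1))%N by apply: cI; lia.
  by have cr : (c (r - k.+1) < m)%N by [apply: cm; lia]; lia.
rewrite Aij; congr (nat_of_bool _)%:R.
have jn := ltn_ord j; have im := ltn_ord i.
apply/andP/existsP=> [[jr /eqP ic]|[k /andP[/eqP jk /eqP ik]]].
  have kr : (j - (n - r) < r)%N by lia.
  exists (Ordinal kr); apply/andP; split=> /=; first by apply/eqP; lia.
  apply/eqP/val_inj => /=.
  have -> : (r - (j - (n - r)).+1 = n - j.+1)%N by lia.
  by have := cm _ jr; lia.
have kr := ltn_ord k; rewrite jk ik /=.
have -> : (n - (n - r + k).+1 = r - k.+1)%N by lia.
have kr' : (r - k.+1 < r)%N by lia.
by rewrite kr'; have := cm _ kr'; split=> //; apply/eqP; lia.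
Qed.

(** * Dependent choices along the chain of spaces *)

(** Induction on the number of maps already treated; [f0] supplies placeholders at the spaces not
    yet reached. *)
Lemma chain_choice_right (l : nat) (T : 'I_l.+1 -> Type)
    (P : forall i, T i -> Prop)
    (R : forall i : 'I_l, T (left_end i) -> T (right_end i) -> Prop)
    (f0 : forall i, T i) :
  (forall i, P i (f0 i)) ->
  (forall i x, P _ x -> exists2 y, P _ y & R i x y) ->
  exists2 f : forall i, T i, forall i, P i (f i) &
    forall i, R i (f (left_end i)) (f (right_end i)).
Proof.
move=> Pf0 step.
suff H k : (k <= l)%N -> exists2 f : forall i, T i, forall i, P i (f i) &
    forall i : 'I_l, (i < k)%N -> R i (f (left_end i)) (f (right_end i)).
  by have [f Pf Rf] := H l (leqnn l); exists f => // i; exact: Rf.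
elim: k => [|k IHk] kl; first by exists f0.
have [f Pf Rf] := IHk (ltnW kl).
pose k0 := Ordinal kl.
have [y Py Ry] := step k0 _ (Pf (left_end k0)).
(* Only space [k + 1] gets a new value, and maps of index below [k] do not touch it. *)
exists (dfwith f y) => [i|i]; first by case: dfwithP.
rewrite ltnS leq_eqVlt => /predU1P[ik|ik].
  have -> : i = k0 by exact: val_inj.
  rewrite dfwith_in dfwith_out //.
  by apply/eqP=> /(congr1 val); rewrite /= /bump; lia.
rewrite !dfwith_out; first exact: Rf.
  by apply/eqP=> /(congr1 val); rewrite /= /bump; lia.
by apply/eqP=> /(congr1 val); rewrite /= /bump; lia.
Qed.

Lemma chain_choice_left (l : nat) (T : 'I_l.+1 -> Type)
    (P : forall i, T i -> Prop)
    (R : forall i : 'I_l, T (left_end i) -> T (right_end i) -> Prop)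
    (f0 : forall i, T i) :
  (forall i, P i (f0 i)) ->
  (forall i y, P _ y -> exists2 x, P _ x & R i x y) ->
  exists2 f : forall i, T i, forall i, P i (f i) &
    forall i, R i (f (left_end i)) (f (right_end i)).
Proof.
move=> Pf0 step.
suff H k : (k <= l)%N -> exists2 f : forall i, T i, forall i, P i (f i) &
    forall i : 'I_l, (l - k <= i)%N -> R i (f (left_end i)) (f (right_end i)).
  have [f Pf Rf] := H l (leqnn l); exists f => // i.
  by apply: Rf; rewrite subnn.
elim: k => [|k IHk] kl.
  by exists f0 => // i; have := ltn_ord i; lia.
have [f Pf Rf] := IHk (ltnW kl).
have k0P : (l - k.+1 < l)%N by lia.
pose k0 := Ordinal k0P.
have [x Px Rx] := step k0 _ (Pf (right_end k0)).
(* Only space [l - k - 1] gets a new value, and the maps already treated lie strictly to its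
   right. *)
exists (dfwith f x) => [i|i]; first by case: dfwithP.
rewrite leq_eqVlt => /predU1P[ik|ik].
  have -> : i = k0 by exact: val_inj.
  rewrite dfwith_in dfwith_out //.
  by apply/eqP=> /(congr1 val); rewrite /= /bump; lia.
rewrite !dfwith_out; first by apply: Rf; lia.
  by apply/eqP=> /(congr1 val); rewrite /= /bump; lia.
by apply/eqP=> /(congr1 val); rewrite /= /bump; lia.
Qed.

(** * Single maps, and the two passes along the zigzag *)

Lemma act_map_mul (F : fieldType) (d : direction) (p q : nat)
    (h h' : 'M[F]_p) (g g' : 'M[F]_q) (A : zigzag_map F d p q) :
  h \in unitmx -> h' \in unitmx -> g \in unitmx -> g' \in unitmx ->
  act_map (h' *m h) (g' *m g) A = act_map h' g' (act_map h g A).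
Proof.
have invM r (a b : 'M[F]_r) : a \in unitmx -> b \in unitmx ->
    invmx (a *m b) = invmx b *m invmx a.
  move=> ua ub; have uab : a *m b \in unitmx by rewrite unitmx_mul ua.
  by rewrite -[RHS](mulKmx uab) -mulmxA (mulmxA b) (mulmxV ub) mul1mx mulmxV // mulmx1.
by case: d A => A uh uh' ug ug' /=; rewrite invM // !mulmxA.
Qed.

(** In both directions the triangular factor sits on the side of the left space, so a change of the
    left basis alone can remove it. *)
Definition reducible_map (F : fieldType) (d : direction) (p q : nat) :
    zigzag_map F d p q -> Prop :=
  match d with
  | Forward => fun A => exists B (u : 'M[F]_p),
      [/\ barcode B, upper_unit u & A = B *m u]
  | Backward => fun A => exists B (u : 'M[F]_p),
      [/\ barcode (antitr B), upper_unit u & A = u *m B]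
  end.

Lemma act_map_reducible (F : fieldType) (d : direction) (p q : nat)
    (A : zigzag_map F d p q) (h : 'M[F]_p) :
  h \in unitmx ->
  exists2 g : 'M[F]_q, g \in unitmx & reducible_map (act_map h g A).
Proof.
case: d A => A uh /=.
  have [g [B [u [ug bB uu gA]]]] := barcode_reduction (A *m invmx h).
  by exists g => //; exists B, u; rewrite -mulmxA.
have [g [B [u [ug bB uu gA]]]] := barcode_reduction (antitr (h *m A)).
(* A backward map is multiplied by the inverse of the right basis change, so the reflected row
   operations enter inverted. *)
exists (invmx (antitr g)); first by rewrite unitmx_inv antitr_unit.
exists (antitr B), (antitr u); split; rewrite ?antitrK ?antitr_upper_unit //.
by rewrite invmxK -antitrM -gA antitrM antitrK.
Qed.

(** The change [g] on the right is moved across [B], and the left change cancels both the result and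
    [u]. That left change is again upper triangular, so the argument can continue leftwards. *)
Lemma reducible_map_barcode (F : fieldType) (d : direction) (p q : nat)
    (A : zigzag_map F d p q) (g : 'M[F]_q) :
  reducible_map A -> upper_unit g ->
  exists2 h : 'M[F]_p, upper_unit h & map_barcode_form (act_map h g A).
Proof.
case: d A => A /= [B [u [bB uu ->]]] ug.
  have [h uh gB] := barcode_stabilizer bB ug.
  exists (h *m u); first exact: upper_unitM.
  have uhu := upper_unit_unit (upper_unitM uh uu).
  by rewrite mulmxA gB -(mulmxA B) mulmxK //; exact: barcodeW.
have [h uh gB] := barcode_stabilizer bB (antitr_upper_unit ug).
exists (antitr h *m invmx u).
  by rewrite upper_unitM ?antitr_upper_unit ?upper_unitV.
rewrite -(mulmxA _ (invmx u)) mulKmx ?upper_unit_unit // -(antitrK B) -antitrM -gB.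
rewrite antitrM !antitrK mulmxK ?upper_unit_unit //.
exact: barcode_antitrW.
Qed.

Theorem proposition5p4 (F : fieldType) (l : nat) (n : 'I_l.+1 -> nat)
    (tau : 'I_l -> direction) (A : zigzag_module F n tau) :
  exists g : forall i : 'I_l.+1, 'M[F]_(n i),
    (forall i : 'I_l.+1, g i \in unitmx) /\
    zigzag_barcode_form (zigzag_act g A).
Proof.
(* First pass, left to right: each left basis is fixed and the next one is chosen to make the map
   reducible. *)
have [g ug rA] := @chain_choice_right l (fun i => 'M[F]_(n i))
  (fun i x => x \in unitmx) (fun i x y => reducible_map (act_map x y (A i)))
  (fun i => 1%:M) (fun i => unitmx1 _ _)
  (fun i x ux => act_map_reducible (A i) ux).
(* Second pass, right to left, on the module already transformed by [g]. *)
have [h uh bA] := @chain_choice_left l (fun i => 'M[F]_(n i))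
  (fun i x => upper_unit x)
  (fun i x y => map_barcode_form (act_map x y (zigzag_act g A i)))
  (fun i => 1%:M) (fun i => upper_unit1 _ _)
  (fun i y uy => reducible_map_barcode (rA i) uy).
exists (fun i => h i *m g i); split=> i.
  by rewrite unitmx_mul ug (upper_unit_unit (uh i)).
by rewrite /zigzag_act act_map_mul ?ug ?upper_unit_unit //; exact: bA.
Qed.
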